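(* Let $\tau>0$, let $M$ be a diagonal real $N\times N$ matrix with positive diagonal entries, let $A$ be a symmetric positive semidefinite real $N\times N$ matrix partitioned into blocks $A=(A_{\alpha\beta})_{\alpha,\beta=1}^{L}$, and let $F\in\mathbb{R}^N$. Let $A^{(1)}=\mathrm{diag}(A_{11},A_{22},\dots,A_{LL})$ be the block diagonal part of $A$ and $A^{(2)}=A-A^{(1)}$. Let $\theta\in\mathbb{R}$ be such that $$\Big(\theta-\frac12\Big)A^{(1)}\ge\frac12 A^{(2)},$$ and let $(u^n)_{n\ge 0}$ be a sequence in $\mathbb{R}^N$ satisfying the two-level implicit-explicit scheme $$M\,\frac{u^{n+1}-u^n}{\tau}+A^{(1)}\big(\theta u^{n+1}+(1-\theta)u^n\big)+A^{(2)}u^n=F,\qquad n=0,1,2,\dots$$ Then the scheme is stable in the sense that, for every $n\ge 0$, $$\|u^{n+1}\|_A^2\le\|u^n\|_A^2+\frac{\tau}{2}\,\|F\|_{M^{-1}}^2 .$$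
   Context: $(\cdot,\cdot)$ is the Euclidean inner product on $\mathbb{R}^N$. The partition into blocks corresponds to a decomposition $N=N_1+\dots+N_L$, with $A_{\alpha\beta}$ of size $N_\alpha\times N_\beta$ ($L$ is the number of continua). For symmetric matrices, $B\ge C$ means $(Bv,v)\ge(Cv,v)$ for all $v\in\mathbb{R}^N$. For a symmetric positive semidefinite matrix $B$, $\|v\|_B^2:=(Bv,v)$ (a seminorm in general). $\tau$ is the uniform time step and $u^n$ is the approximation at time $t_n=n\tau$ for the semi-discrete system $M\,\partial_t u+Au=F$ obtained from the space discretization of a multicontinuum flow problem. *)

(* Defs.v *)
From mathcomp Require Import all_boot all_order all_algebra.

Set Implicit Arguments.
Unset Strict Implicit.
Unset Printing Implicit Defensive.

Import Order.TTheory GRing.Theory Num.Theory.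
Local Open Scope ring_scope.

Section QuadraticForms.
Variables (R : realFieldType) (n : nat).
Implicit Types (u v : 'cV[R]_n) (B C : 'M[R]_n).

Definition dot u v : R := \sum_(i < n) u i 0 * v i 0.

(* A seminorm squared only for B symmetric positive semidefinite. *)
Definition sqnorm B v : R := dot (B *m v) v.

(* The order B >= C; meant for symmetric B and C. *)
Definition mxge B C : Prop := forall v, dot (C *m v) v <= dot (B *m v) v.

Definition spsd B : Prop := B^T = B /\ mxge B 0.

End QuadraticForms.

Section BlockSplitting.
Variables (R : realFieldType) (L : nat) (N_ : 'I_L -> nat).

(* The partition N = N_1 + ... + N_L is encoded in the dimension of A;
   [submxblock A a b] is the N_a x N_b block of A. *)
Definition blockdiag_part (A : 'M[R]_(\sum_a N_ a)) : 'M[R]_(\sum_a N_ a) :=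
  \mxdiag_(a < L) submxblock A a a.

Definition offdiag_part (A : 'M[R]_(\sum_a N_ a)) : 'M[R]_(\sum_a N_ a) :=
  A - blockdiag_part A.

End BlockSplitting.

(* Main.v *)
(** Put [d = u^{n+1} - u^n], [A1 = A^(1)] and [A2 = A^(2)]. Since
    [A = A1 + A2], the scheme reads [M d / tau + A u^n + theta A1 d = F].
    Pairing it with [2 d] and using
    [(A u^{n+1}, u^{n+1}) = (A u^n, u^n) + 2 (A u^n, d) + (A d, d)] gives
    [|u^{n+1}|_A^2 - |u^n|_A^2 = 2 (F, d) - (2 / tau) (M d, d)
       - 2 (((theta - 1/2) A1 - A2 / 2) d, d)].
    The last term is nonpositive by hypothesis, and Young's inequality for the
    dual norms of [M^-1] and [M] bounds [2 (F, d)]. *)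

Require Import Defs.
From mathcomp Require Import all_boot all_order all_algebra.
From mathcomp Require Import ring lra.

Set Implicit Arguments.
Unset Strict Implicit.
Unset Printing Implicit Defensive.

Import Order.TTheory GRing.Theory Num.Theory.
Local Open Scope ring_scope.

Section DotProduct.
Variables (R : realFieldType) (n : nat).
Implicit Types (u v w : 'cV[R]_n) (B : 'M[R]_n).

Lemma dotC u v : dot u v = dot v u.
Proof. by apply: eq_bigr => i _; rewrite mulrC. Qed.

Lemma dotDl u v w : dot (u + v) w = dot u w + dot v w.
Proof.
by rewrite /dot -big_split; apply: eq_bigr => i _; rewrite mxE mulrDl.
Qed.

Lemma dotZl a u v : dot (a *: u) v = a * dot u v.
Proof. by rewrite /dot big_distrr; apply: eq_bigr => i _; rewrite mxE -mulrA. Qed.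

Lemma dotDr u v w : dot u (v + w) = dot u v + dot u w.
Proof. by rewrite dotC dotDl !(dotC u). Qed.

Lemma dotZr a u v : dot u (a *: v) = a * dot u v.
Proof. by rewrite dotC dotZl dotC. Qed.

Lemma dot_mulmxl B u v : dot (B *m u) v = dot u (B^T *m v).
Proof.
have dotE x y : dot x y = (x^T *m y) 0 0.
  by rewrite mxE; apply: eq_bigr => i _; rewrite mxE.
by rewrite !dotE trmx_mul mulmxA.
Qed.

(** Symmetry merges the two cross terms. This expansion serves both to complete the square in
    [dot_young] and to compare the energies of [u n] and [u n + d]. *)
Lemma sqnormD B u v : B^T = B ->
  sqnorm B (u + v) = sqnorm B u + 2 * dot (B *m u) v + sqnorm B v.
Proof.
move=> symB; rewrite /sqnorm mulmxDr !dotDl !dotDr.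
by rewrite [dot (B *m v) u]dot_mulmxl symB [dot v _]dotC; ring.
Qed.

Lemma sqnormZ B a v : sqnorm B (a *: v) = a ^+ 2 * sqnorm B v.
Proof. by rewrite /sqnorm -scalemxAr dotZl dotZr mulrA. Qed.

Lemma spsd_sqnorm_ge0 B v : spsd B -> 0 <= sqnorm B v.
Proof.
case=> _ /(_ v); suff -> : dot (0 *m v) v = 0 by [].
by rewrite mul0mx -[0](scale0r v) dotZl mul0r.
Qed.

(** With [g] solving [B *m g = u], the dual norm of [u] is the [B]-norm of [g], and the gap between
    the two sides is the square [2 / a * sqnorm B (v - (a / 2) *: g)]. *)
Lemma dot_young B a u v : spsd B -> B \in unitmx -> 0 < a ->
  2 * dot u v <= 2 / a * sqnorm B v + a / 2 * sqnorm (invmx B) u.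
Proof.
move=> psdB unitB a_gt0; set g := invmx B *m u.
have uE : u = B *m g by rewrite mulKVmx.
have -> : sqnorm (invmx B) u = sqnorm B g.
  by rewrite /sqnorm -/g dotC -uE.
have: 0 <= 2 / a * sqnorm B (- (a / 2) *: g + v).
  by rewrite mulr_ge0 ?spsd_sqnorm_ge0 // divr_ge0 // ltW.
rewrite sqnormD; last by case: psdB.
rewrite sqnormZ -scalemxAr dotZl -uE => h; rewrite -subr_ge0.
suff <- : 2 / a * ((- (a / 2)) ^+ 2 * sqnorm B g + 2 * (- (a / 2) * dot u v)
           + sqnorm B v) =
  2 / a * sqnorm B v + a / 2 * sqnorm B g - 2 * dot u v by [].
by field; rewrite gt_eqF.
Qed.

Lemma pos_diag_spsd B : is_diag_mx B -> (forall i, 0 < B i i) -> spsd B.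
Proof.
move=> /diag_mxP[d ->] d_gt0; split; first exact: tr_diag_mx.
move=> v; rewrite mul0mx /dot; apply: ler_sum => i _.
rewrite mul_diag_mx !mxE mul0r -mulrA mulr_ge0 -?expr2 ?sqr_ge0 //.
by have := d_gt0 i; rewrite mxE eqxx => /ltW.
Qed.

Lemma pos_diag_unitmx B :
  is_diag_mx B -> (forall i, 0 < B i i) -> B \in unitmx.
Proof.
move=> /diag_mxP[d ->] d_gt0; rewrite unitmxE det_diag unitfE.
apply/prodf_neq0 => i _.
by have := d_gt0 i; rewrite mxE eqxx => /gt_eqF ->.
Qed.

End DotProduct.

Theorem theorem3 (R : realFieldType) (L : nat) (N_ : 'I_L -> nat)
    (tau theta : R) (M A : 'M[R]_(\sum_a N_ a)) (F : 'cV[R]_(\sum_a N_ a))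
    (u : nat -> 'cV[R]_(\sum_a N_ a)) :
  0 < tau ->
  is_diag_mx M ->
  (forall i, 0 < M i i) ->
  spsd A ->
  mxge ((theta - 2^-1) *: blockdiag_part A) (2^-1 *: offdiag_part A) ->
  (forall n : nat,
     M *m (tau^-1 *: (u n.+1 - u n))
     + blockdiag_part A *m (theta *: u n.+1 + (1 - theta) *: u n)
     + offdiag_part A *m u n = F) ->
  forall n : nat,
    sqnorm A (u n.+1) <= sqnorm A (u n) + tau / 2 * sqnorm (invmx M) F.
Proof.
move=> tau_gt0 diagM M_gt0 psdA hyp scheme n.
set A1 := blockdiag_part A in hyp scheme; set A2 := offdiag_part A in hyp scheme.
set d := u n.+1 - u n; have uS : u n.+1 = u n + d by rewrite addrC subrK.
have AE : A = A1 + A2 by rewrite addrC subrK.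
have := scheme n; rewrite -/d => {}scheme.
clearbody A1 A2 d.
have FE : F = tau^-1 *: (M *m d) + A *m u n + theta *: (A1 *m d).
  (* The weighted average is [u n] plus a correction along [d], so the [A1] and [A2] terms at [u n]
     add up to [A *m u n]. *)
  have midE : theta *: u n.+1 + (1 - theta) *: u n = u n + theta *: d.
    by rewrite uS scalerDr addrAC -scalerDl addrC subrKC scale1r addrC.
  rewrite -scheme midE AE mulmxDl mulmxDr -!scalemxAr !addrA.
  exact: addrAC.
have Fd : dot F d = tau^-1 * sqnorm M d + dot (A *m u n) d
                    + theta * dot (A1 *m d) d.
  by rewrite {1}FE !dotDl !dotZl.
have Ad : sqnorm A d = dot (A1 *m d) d + dot (A2 *m d) d.
  by rewrite /sqnorm {1}AE mulmxDl dotDl.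
have := hyp d; rewrite -!scalemxAl !dotZl => hypd.
(* The choice [a = tau] makes the Young term [2 / tau * sqnorm M d] cancel exactly the one that [Fd]
   contributes. *)
have := dot_young F d (pos_diag_spsd diagM M_gt0)
  (pos_diag_unitmx diagM M_gt0) tau_gt0.
rewrite uS sqnormD; last by case: psdA.
(* The bound is Young's inequality plus twice [hypd], which gives [sqnorm A d <= 2 * theta * dot (A1
   *m d) d]. *)
by rewrite Fd Ad; lra.
Qed.
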